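(* Let $f:\mathbb{R}^n\to\mathbb{R}^n$ be locally Lipschitz and consider the dynamical system $\dot x=f(x)$. Let $h:\mathbb{R}^n\to\mathbb{R}$ be continuously differentiable and let $\mathcal{C}\subset\mathbb{R}^n$ be a nonempty, compact set such that $$\mathcal{C}=\{x\in\mathbb{R}^n: h(x)\ge 0\},\quad \partial\mathcal{C}=\{x\in\mathbb{R}^n: h(x)=0\},\quad \mathrm{Int}(\mathcal{C})=\{x\in\mathbb{R}^n: h(x)>0\}.$$ Suppose that $L_fh(x)>0$ for all $x\in\partial\mathcal{C}$. Then $B=\frac{1}{h}:\mathrm{Int}(\mathcal{C})\to\mathbb{R}$ is a reciprocal barrier function for $\mathcal{C}$, and $h:\mathcal{C}\to\mathbb{R}$ is a zeroing barrier function for $\mathcal{C}$ (defined on $\mathcal{D}=\mathcal{C}$).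
   Context: $\mathrm{Int}(\mathcal{C})$ and $\partial\mathcal{C}$ denote the interior and boundary of $\mathcal{C}$. $L_fh(x)=\frac{\partial h}{\partial x}(x)f(x)$ and $L_fB(x)=\frac{\partial B}{\partial x}(x)f(x)$ are Lie derivatives. A continuous function $\beta:[0,a)\to[0,\infty)$, for some $a>0$ (possibly $a=\infty$), is of class $\mathcal{K}$ if it is strictly increasing and $\beta(0)=0$. A continuous function $\alpha:(-b,a)\to(-\infty,\infty)$, for some $a,b>0$ (possibly infinite), is of extended class $\mathcal{K}$ if it is strictly increasing and $\alpha(0)=0$. Whenever such a function is evaluated, its argument is understood to lie in its domain. Reciprocal barrier function (RBF) for $\mathcal{C}$: a continuously differentiable function $B:\mathrm{Int}(\mathcal{C})\to\mathbb{R}$ for which there exist class $\mathcal{K}$ functions $\alpha_1,\alpha_2,\alpha_3$ such that for all $x\in\mathrm{Int}(\mathcal{C})$, $\frac{1}{\alpha_1(h(x))}\le B(x)\le\frac{1}{\alpha_2(h(x))}$ and $L_fB(x)\le\alpha_3(h(x))$. Zeroing barrier function (ZBF) for $\mathcal{C}$ defined on a set $\mathcal{D}$ with $\mathcal{C}\subseteq\mathcal{D}\subset\mathbb{R}^n$: there exists an extended class $\mathcal{K}$ function $\alpha$ such that $L_fh(x)\ge-\alpha(h(x))$ for all $x\in\mathcal{D}$. *)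

(* Defs.v *)
(* MathComp-Analysis; points of R^n are row vectors 'rV[R]_n with the
   library's max norm, which is equivalent to the Euclidean one. *)
From HB Require Import structures.
From mathcomp Require Import all_boot all_order all_algebra.
From mathcomp Require Import all_classical all_reals all_analysis.
Export numFieldNormedType.Exports.

Set Implicit Arguments.
Unset Strict Implicit.
Unset Printing Implicit Defensive.
Import Order.TTheory GRing.Theory Num.Theory.

Local Open Scope classical_set_scope.
Local Open Scope ring_scope.

Definition boundary (T : topologicalType) (A : set T) : set T :=
  closure A `\` interior A.

Definition locally_lipschitz (R : realType) (V W : normedModType R)
    (f : V -> W) : Prop :=
  forall x : V, exists2 U : set V, nbhs x U & [lipschitz f y | y in U].

(* Only used for open U, where the values of g off U are irrelevant. *)
Definition continuously_differentiable_on (R : realType) (n : nat)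
    (U : set 'rV[R]_n) (g : 'rV[R]_n -> R) : Prop :=
  forall x : 'rV[R]_n, U x ->
    differentiable g x /\
    forall i : 'I_n, {for x, continuous ('D_(delta_mx 0 i) g)}.

(* (dg/dx)(x) applied to f(x), for g differentiable at x. *)
Definition lie_derivative (R : realType) (n : nat)
    (f : 'rV[R]_n -> 'rV[R]_n) (g : 'rV[R]_n -> R) (x : 'rV[R]_n) : R :=
  'd g x (f x).

(* A function on [0, a) or (-b, a) is represented by a function on R of which
   only the values on that interval matter; a and b may be +oo. *)
Definition classK_dom (R : realType) (a : \bar R) : set R :=
  [set s | 0 <= s /\ (s%:E < a)%E].

Definition ext_classK_dom (R : realType) (b a : \bar R) : set R :=
  [set s | (- b < s%:E)%E /\ (s%:E < a)%E].

Definition strictly_increasing_on (R : realType) (D : set R) (u : R -> R) :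
    Prop :=
  forall s t : R, D s -> D t -> s < t -> u s < u t.

Definition classK (R : realType) (a : \bar R) (beta : R -> R) : Prop :=
  [/\ (0 < a)%E,
      {within classK_dom a, continuous beta},
      forall s : R, classK_dom a s -> 0 <= beta s,
      strictly_increasing_on (classK_dom a) beta &
      beta 0 = 0].

Definition ext_classK (R : realType) (b a : \bar R) (alpha : R -> R) : Prop :=
  [/\ (0 < b)%E, (0 < a)%E,
      {within ext_classK_dom b a, continuous alpha},
      strictly_increasing_on (ext_classK_dom b a) alpha &
      alpha 0 = 0].

(* Each comparison function is only evaluated inside its domain, hence the
   membership conditions on h x here and in the next definition. *)
Definition reciprocal_barrier_function (R : realType) (n : nat)
    (f : 'rV[R]_n -> 'rV[R]_n) (h : 'rV[R]_n -> R) (C : set 'rV[R]_n)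
    (B : 'rV[R]_n -> R) : Prop :=
  continuously_differentiable_on (interior C) B /\
  exists (a1 a2 a3 : \bar R) (alpha1 alpha2 alpha3 : R -> R),
    [/\ classK a1 alpha1, classK a2 alpha2, classK a3 alpha3 &
        forall x : 'rV[R]_n, interior C x ->
          [/\ classK_dom a1 (h x), classK_dom a2 (h x) & classK_dom a3 (h x)] /\
          [/\ 1 / alpha1 (h x) <= B x,
              B x <= 1 / alpha2 (h x) &
              lie_derivative f B x <= alpha3 (h x)]].

Definition zeroing_barrier_function (R : realType) (n : nat)
    (f : 'rV[R]_n -> 'rV[R]_n) (h : 'rV[R]_n -> R) (C D : set 'rV[R]_n) :
    Prop :=
  C `<=` D /\
  exists (b a : \bar R) (alpha : R -> R),
    ext_classK b a alpha /\
    forall x : 'rV[R]_n, D x ->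
      ext_classK_dom b a (h x) /\ - alpha (h x) <= lie_derivative f h x.

(* Main.v *)
Require Import Defs.
From HB Require Import structures.
From mathcomp Require Import all_boot all_order all_algebra.
From mathcomp Require Import all_classical all_reals all_analysis.
Import Order.TTheory GRing.Theory Num.Theory.
Local Open Scope classical_set_scope.
Local Open Scope ring_scope.

(* By compactness, any continuous g that is positive on the zero set of a
   continuous u >= 0 on C satisfies g >= - K u on C for some K > 0. Applied to
   g = L_f h this gives the zeroing barrier inequality with u = h, and the
   reciprocal one with u = h ^ 3, since L_f (1 / h) = - L_f h / h ^ 2. *)

Lemma locally_lipschitz_continuous (R : realType) (V W : normedModType R)
    (f : V -> W) : locally_lipschitz f -> continuous f.
Proof.
move=> f_lip x; have [U xU /pinfty_ex_gt0[M M_gt0 fU]] := f_lip x.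
apply/cvgrPdist_lt => e e_gt0.
have : \forall y \near x, U y /\ `|x - y| < e / M.
  by apply: filterI => //; apply: cvgr_dist_lt; [exact: cvg_id|exact: divr_gt0].
apply: filterS => y [Uy xy].
have /= le_f := fU (x, y) (conj (nbhs_singleton xU) Uy).
by rewrite (le_lt_trans le_f)// mulrC -ltr_pdivlMr.
Qed.

(** Continuous differentiability is phrased through the partial derivatives ['D_(delta_mx 0 i) g];
    this expansion lets their continuity pass to the Lie derivative. *)
Lemma lie_derivative_sum (R : realType) (n : nat) (f : 'rV[R]_n -> 'rV[R]_n)
    (g : 'rV[R]_n -> R) (x : 'rV[R]_n) : differentiable g x ->
  lie_derivative f g x = \sum_(i < n) f x 0 i * 'D_(delta_mx 0 i) g x.
Proof.
move=> dg; rewrite /lie_derivative [X in 'd g x X]row_sum_delta linear_sum.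
by apply: eq_bigr => i _; rewrite linearZ deriveE.
Qed.

Lemma lie_derivative_continuous (R : realType) (n : nat)
    (f : 'rV[R]_n -> 'rV[R]_n) (g : 'rV[R]_n -> R) :
  continuous f -> continuously_differentiable_on setT g ->
  continuous (lie_derivative f g).
Proof.
move=> cf g_C1; have -> : lie_derivative f g =
    fun x => \sum_(i < n) f x 0 i * 'D_(delta_mx 0 i) g x.
  by apply/funext => x; apply: lie_derivative_sum; have [] := g_C1 x I.
move=> x; apply: (@cvg_big _ _ _ _ _ _ _ _ _ _ _ (nbhs_filter x)) => [|i _].
  exact: add_continuous.
apply: cvgM; last by have [_] := g_C1 x I; exact.
apply: (continuous_comp (g := fun v : 'rV[R]_n => v 0 i) (cf x)).
exact: coord_continuous.
Qed.

Lemma continuously_differentiable_onV (R : realType) (n : nat)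
    (U : set 'rV[R]_n) (g : 'rV[R]_n -> R) :
  continuously_differentiable_on setT g -> (forall x, U x -> g x != 0) ->
  continuously_differentiable_on U (fun x => (g x)^-1).
Proof.
move=> g_C1 g_neq0 x /g_neq0 gx0.
have dg y : differentiable g y by have [] := g_C1 y I.
have cg y : {for y, continuous g} by exact: differentiable_continuous.
split=> [|i]; first exact: differentiableV.
(* The quotient rule holds only where [g] does not vanish. This is a neighbourhood of [x] by
   continuity of [g], whether or not [U] is open, and continuity at [x] depends only on values near
   [x]. *)
have eqD : \forall y \near x, - g y ^- 2 * 'D_(delta_mx 0 i) g y =
    'D_(delta_mx 0 i) (fun z => (g z)^-1) y.
  have : \forall y \near x, g y != 0 by exact: cvgr_neq0 (cg x) gx0.
  apply: filterS => y gy0.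
  by rewrite deriveV //; exact: diff_derivable.
rewrite /prop_for /continuous_at -(nbhs_singleton eqD).
apply: cvg_trans; first exact: near_eq_cvg eqD.
apply: cvgM; last by have [_] := g_C1 x I; exact.
apply: cvgN; apply: cvgV; first by rewrite expf_neq0.
by apply: (continuous_comp (g := fun s : R => s ^+ 2) (cg x)); exact: exprn_continuous.
Qed.

(** Each point of [C] has a neighbourhood on which one constant works. Since [u >= 0] on [C], every
    larger constant works there too, so compactness, in its near-covering form with [K] tending to
    [+oo], yields a common one. *)
Lemma compact_ge_opp_scale (R : realType) (T : topologicalType) (C : set T)
    (g u : T -> R) :
  compact C -> continuous g -> continuous u ->
  (forall x, C x -> 0 <= u x) -> (forall x, C x -> u x = 0 -> 0 < g x) ->
  exists2 K : R, 0 < K & forall x, C x -> - (K * u x) <= g x.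
Proof.
move=> /compact_near_coveringP C_compact cg cu u_ge0 g_gt0.
(* The guard [C x] inside the set is kept because the neighbourhoods are taken in [T] and may leave
   [C], where the sign of [u] is unknown. *)
suff /pinfty_ex_gt0[K K_gt0 CK] :
    \forall K \near +oo, C `<=` [set x | C x -> - (K * u x) <= g x].
  by exists K => // x Cx; exact: CK.
apply: C_compact => x Cx.
have [K0 gK0] : exists K0, 0 < g x + K0 * u x.
  have [ux0|ux0] := eqVneq (u x) 0.
    by exists 0; rewrite mul0r addr0; exact: g_gt0.
  (* Chosen so that [g x + K0 * u x = 1]. *)
  exists ((1 - g x) / u x); rewrite divfK// addrC subrK; exact: ltr01.
have : \forall y \near x & K \near +oo, 0 < g y + K0 * u y /\ K0 <= K.
  exists ([set y | 0 < g y + K0 * u y], [set K | K0 <= K]); last by case.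
  split; last by apply: nbhs_pinfty_ge; exact: num_real.
  apply: (cvgr_gt (g x + K0 * u x)) => //.
  by apply: cvgD; [exact: cg|apply: cvgM; [exact: cvg_cst|exact: cu]].
apply: filterS => -[y K] /= [gy K0K] Cy.
rewrite lerNl -subr_ge0 opprK addrC.
apply: (le_trans (ltW gy)); rewrite lerD2l.
by apply: ler_wpM2r => //; exact: u_ge0.
Qed.

Lemma classK_scale (R : realType) (K : R) : 0 < K ->
  classK +oo%E (fun s : R => K * s).
Proof.
move=> K_gt0; split=> //.
- by apply: continuous_subspaceT => s; apply: cvgM; [exact: cvg_cst|exact: cvg_id].
- by move=> s [s_ge0 _]; rewrite mulr_ge0// ltW.
- by move=> s t _ _ st; rewrite ltr_pM2l.
- by rewrite mulr0.
Qed.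

Lemma ext_classK_scale (R : realType) (K : R) : 0 < K ->
  ext_classK +oo%E +oo%E (fun s : R => K * s).
Proof.
move=> K_gt0; split=> //.
- by apply: continuous_subspaceT => s; apply: cvgM; [exact: cvg_cst|exact: cvg_id].
- by move=> s t _ _ st; rewrite ltr_pM2l.
- by rewrite mulr0.
Qed.

Theorem theorem2 (R : realType) (n : nat)
    (f : 'rV[R]_n -> 'rV[R]_n) (h : 'rV[R]_n -> R) (C : set 'rV[R]_n)
    (f_lip : locally_lipschitz f)
    (h_C1 : continuously_differentiable_on setT h)
    (C_neq0 : C !=set0)
    (C_compact : compact C)
    (C_def : C = [set x | 0 <= h x])
    (C_boundary : boundary C = [set x | h x = 0])
    (C_interior : interior C = [set x | 0 < h x])
    (Lfh_gt0 : forall x : 'rV[R]_n, boundary C x -> 0 < lie_derivative f h x) :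
  reciprocal_barrier_function f h C (fun x : 'rV[R]_n => 1 / h x) /\
  zeroing_barrier_function f h C C.
Proof.
have cLfh : continuous (lie_derivative f h).
  exact/lie_derivative_continuous/h_C1/locally_lipschitz_continuous.
have dh x : differentiable h x by have [] := h_C1 x I.
have ch : continuous h by move=> x; exact: differentiable_continuous.
have h_ge0 x : C x -> 0 <= h x by rewrite C_def.
have h_gt0 x : interior C x -> 0 < h x by rewrite C_interior.
have Lfh_gt x : h x = 0 -> 0 < lie_derivative f h x.
  by move=> hx0; apply: Lfh_gt0; rewrite C_boundary.
split.
  (* The exponent 3 is what leaves the linear bound [K * h x] after division by [h x ^+ 2]. *)
  have [K K_gt0 LfhK] : exists2 K : R, 0 < K &
      forall x, C x -> - (K * h x ^+ 3) <= lie_derivative f h x.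
    apply: compact_ge_opp_scale => //.
    - move=> x; apply: (continuous_comp (g := fun s : R => s ^+ 3) (ch x)).
      exact: exprn_continuous.
    - by move=> x /h_ge0 hx; exact: exprn_ge0.
    - by move=> x _ /eqP; rewrite expf_eq0 => /eqP /Lfh_gt.
  have -> : (fun x => 1 / h x) = (fun x => (h x)^-1).
    by apply/funext => x; rewrite div1r.
  split.
    by apply: continuously_differentiable_onV => // x /h_gt0/lt0r_neq0.
  exists +oo%E, +oo%E, +oo%E.
  (* As [B = 1 / h], the identity serves for both bounds on [B], with equality; it is written
     [1 * s] so that [classK_scale] covers all three functions. *)
  exists (fun s => 1 * s), (fun s => 1 * s), (fun s => K * s).
  split; [exact: classK_scale..|].
  move=> x Cx; have hx := h_gt0 x Cx; rewrite !mul1r.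
  split; first by rewrite /classK_dom /= ltry (ltW hx).
  split=> //; rewrite /lie_derivative diffV ?lt0r_neq0//=.
  have := LfhK x (interior_subset Cx); rewrite /lie_derivative.
  (* Multiplying by [h x ^+ 2 > 0] turns the goal into [- L_f h <= K * h x ^+ 3], which is the
     compactness bound. *)
  rewrite lerNl => LfhK_x; change (- h x ^- 2 * 'd h x (f x) <= K * h x).
  by rewrite mulNr -mulrN mulrC ler_pdivrMr ?exprn_gt0// -mulrA -exprS.
split=> //.
have [K K_gt0 LfhK] : exists2 K : R, 0 < K &
    forall x, C x -> - (K * h x) <= lie_derivative f h x.
  by apply: compact_ge_opp_scale => // x _; exact: Lfh_gt.
exists +oo%E, +oo%E, (fun s => K * s); split; first exact: ext_classK_scale.
by move=> x Cx; split; [rewrite /ext_classK_dom /= ltry ltNyr|exact: LfhK].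
Qed.
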